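(* Let $W_2\ge 0$, $W_1>W_2$, $c_1,c_2\ge 0$, $x_{1_{\max}},x_{2_{\max}}>0$, $r\ge 1$, and define $\bar c_1=\frac{c_1}{W_1-W_2}$, $\bar c_2=\frac{c_2}{W_1-W_2}$, $\alpha=\left(\frac{x_{1_{\max}}}{x_{2_{\max}}}\right)^r$. Player 2's optimal strategy $x_2^*$, i.e. an effort maximizing Player 2's expected utility $E[u_2(x_2)]$ (defined in the context) over $x_2\ge 0$, is given as follows. If $\bar c_1\bar c_2\ge 1$: $$x_2^*=\begin{cases} x_{1_{\max}}\sqrt[r]{\frac{1}{1+\bar c_1}}, & 0\le\alpha<\frac{1+\bar c_1}{1+\bar c_2},\\ 0, & \frac{1+\bar c_1}{1+\bar c_2}\le\alpha.\end{cases}$$ Otherwise, if $\bar c_1\bar c_2<1$: $$x_2^*=\begin{cases} x_{1_{\max}}\sqrt[r]{\frac{1}{1+\bar c_1}}, & 0\le\alpha<\alpha^*,\\ x_{2_{\max}}\sqrt[r]{\frac12(1-\bar c_2\alpha)}, & \alpha^*\le\alpha<\frac{1}{\bar c_2},\\ 0, & \frac{1}{\bar c_2}\le\alpha,\end{cases}$$ where $$\alpha^*=\frac{2+\bar c_2+2\sqrt{\frac{\bar c_1(1+\bar c_2)}{1+\bar c_1}}}{4\frac{1+\bar c_2}{1+\bar c_1}+\bar c_2^2}.$$ When $\bar c_2=0$, $\frac{1}{\bar c_2}$ is read as $+\infty$.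
   Context: Two-player sequential contest. Player 2 (leader) attempts effort $x_2\ge0$ first; Player 1 (follower) observes the outcome and then best-responds. The winner receives $W_1$, the loser $W_2$; Player $i$ pays $c_i$ upon failing. The player who successfully invests more effort wins, ties going to Player 1, and if Player 2 fails then Player 1 wins. For $i\in\{1,2\}$, Player $i$'s probability of failing to achieve effort $x\ge0$ is $$f_i(x)=\begin{cases}\left(\frac{x}{x_{i_{\max}}}\right)^r, & 0\le x<x_{i_{\max}},\\ 1, & x\ge x_{i_{\max}},\end{cases}$$ and failures of the players are independent. Let $x_{\text{threshold}}=x_{1_{\max}}\sqrt[r]{\frac{1}{1+\bar c_1}}$. Player 1's best response to a successful effort $x_2$ is to attempt $x_2$ if $x_2<x_{\text{threshold}}$ and to attempt $0$ (fold) otherwise. Anticipating this response, Player 2's expected utility is $$E[u_2(x_2)]=\begin{cases} W_1f_1(x_2)(1-f_2(x_2))+W_2(1-f_1(x_2))(1-f_2(x_2))+(W_2-c_2)f_2(x_2), & 0\le x_2<x_{\text{threshold}},\\ W_1(1-f_2(x_2))+(W_2-c_2)f_2(x_2), & x_2\ge x_{\text{threshold}}.\end{cases}$$ At parameter values where Player 2 is indifferent between two maximizers, the formula selects one of them (e.g. at $\alpha=\alpha^*$ it selects $x_{2_{\max}}\sqrt[r]{\frac12(1-\bar c_2\alpha)}$). *)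

(* Defs.v *)
From HB Require Import structures.
From mathcomp Require Import all_boot all_order all_algebra.
From mathcomp Require Import reals ereal exp.

Set Implicit Arguments.
Unset Strict Implicit.
Unset Printing Implicit Defensive.

Import Order.TTheory GRing.Theory Num.Theory.

Local Open Scope ring_scope.

Section SequentialContest.
Context {R : realType}.

(* For y >= 0 and r >= 1. *)
Definition root_r (r y : R) : R := y `^ r^-1.

Definition fail_prob (r xmax x : R) : R :=
  if x < xmax then (x / xmax) `^ r else 1.

Definition norm_cost (W1 W2 c : R) : R := c / (W1 - W2).

Definition strength_ratio (r x1max x2max : R) : R := (x1max / x2max) `^ r.

(* The follower matches a successful effort x of the leader when x lies below
   this threshold, and folds (attempts 0) otherwise. *)
Definition x_threshold (W1 W2 c1 x1max r : R) : R :=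
  x1max * root_r r (1 / (1 + norm_cost W1 W2 c1)).

(* Expected utility of the leader (Player 2) attempting effort x2 when the
   follower (Player 1) best-responds.  Below the threshold the follower matches
   x2 and wins ties, so the leader wins exactly when she succeeds and the
   follower fails; at or above it the follower folds, so she wins exactly when
   she succeeds.  She pays c2 only when she fails, and then she loses. *)
Definition leader_utility (W1 W2 c1 c2 x1max x2max r : R) (x2 : R) : R :=
  let f1 := fail_prob r x1max x2 in
  let f2 := fail_prob r x2max x2 in
  if x2 < x_threshold W1 W2 c1 x1max r then
    W1 * f1 * (1 - f2) + W2 * (1 - f1) * (1 - f2) + (W2 - c2) * f2
  else W1 * (1 - f2) + (W2 - c2) * f2.

(* x is a maximizer, not necessarily unique, of u over the efforts y >= 0. *)
Definition optimal_effort (u : R -> R) (x : R) : Prop :=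
  0 <= x /\ forall y : R, 0 <= y -> u y <= u x.

(* Arguments are the normalized costs of the follower and of the leader. *)
Definition alpha_star (cb1 cb2 : R) : R :=
  (2 + cb2 + 2 * Num.sqrt (cb1 * (1 + cb2) / (1 + cb1))) /
  (4 * ((1 + cb2) / (1 + cb1)) + cb2 ^+ 2).

(* 1 / c as an extended real: the inverse of 0 is +oo there, whereas it is 0
   in the field R. *)
Definition inv_cost (c : R) : \bar R := (c%:E^-1)%E.

Lemma inv_cost0 : inv_cost 0 = +oo%E.
Proof. by rewrite /inv_cost /inve eqxx. Qed.

Lemma inv_cost_neq0 (c : R) : c != 0 -> inv_cost c = (1 / c)%:E.
Proof. by move=> c0; rewrite /inv_cost /inve (negbTE c0) div1r. Qed.

End SequentialContest.

(* Main.v *)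
Require Import Defs.
From mathcomp Require Import all_boot all_order all_algebra.
From mathcomp Require Import reals ereal exp.
From mathcomp Require Import ring lra.

(** Measure efforts by s = (x / x1max)^r, the follower's failure probability as
    long as it is at most 1.  The leader's own failure probability is then
    min (alpha s) 1, the follower folds as soon as s reaches
    e = 1 / (1 + cb1), and up to the positive affine map W2 + (W1 - W2) _ the
    utility becomes [leader_gain]: s (1 - alpha s) - cb2 alpha s while the
    follower matches (and alpha s <= 1), and 1 - (1 + cb2) alpha s once he folds.
    The exponent r and the two scales disappear ([leader_utility_gain],
    [optimal_effort_gain]).

    The folding branch is decreasing, so it is best at s = e.  The matching
    branch is a concave parabola whose peak, at s = (1 - cb2 alpha) / (2 alpha),
    has height (1 - cb2 alpha)^2 / (4 alpha); when cb2 alpha >= 1 it is largest at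
    s = 0, with gain 0.  So only three efforts compete: 0, the peak, and e.

    The peak is at least as good as e exactly when
      q = (1 - cb2 alpha)^2 - 4 alpha (1 - (1 + cb2) e alpha) >= 0,
    a quadratic in alpha whose larger root is [alpha_star].  Its smaller root
    does not matter: up to the value alpha0 at which the peak enters the
    matching region (alpha0 (cb2 + 2 e) = 1) the parabola increases on that
    whole region, hence stays below the folding gain at e, and alpha0 lies
    between the two roots
    ([alpha_star_ge_entry] and [alpha_lt_star]).

    The sign of cb1 cb2 - 1 decides whether, as alpha grows, e stops being
    better than 0 before or after the parabola starts to decrease at 0: the
    first happens at (1 + cb1) / (1 + cb2), the second at 1 / cb2.  If the second
    comes first, the leader moves from e directly to 0. *)

Import Order.TTheory GRing.Theory Num.Theory.

Local Open Scope ring_scope.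

(** * The contest in terms of failure probabilities *)

(** Here [al] is the strength ratio, [e] the failure probability of the follower
    from which he folds, [b] the normalized cost of the leader. *)
Definition leader_gain {R : realType} (al e b s : R) : R :=
  let f2 := Num.min (al * s) 1 in
  if s < e then s * (1 - f2) - b * f2 else 1 - (1 + b) * f2.

Section Reduction.
Context {R : realType}.
Implicit Types (W c x xmax r s t : R).

Lemma root_r_powR r s : 0 < r -> 0 <= s -> root_r r s `^ r = s.
Proof.
by move=> r0 s0; rewrite /root_r -powRrM mulVf ?gt_eqF // powRr1.
Qed.

Lemma root_r_ge0 r s : 0 <= root_r r s.
Proof. exact: powR_ge0. Qed.

Lemma root_r_lt r s t : 0 < r -> 0 <= s -> 0 <= t ->
  (root_r r s < root_r r t) = (s < t).
Proof.
move=> r0 s0 t0.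
have inv0 : 0 < r^-1 by rewrite invr_gt0.
apply/idP/idP; last by apply: gt0_ltr_powR.
rewrite !ltNge; apply: contra => ts.
by apply: ge0_ler_powR => //; exact: ltW.
Qed.

Lemma root_r0 r : 0 < r -> root_r r 0 = 0.
Proof. by move=> r0; rewrite /root_r powR0 // invr_eq0 gt_eqF. Qed.

Lemma root_r1 r : root_r r 1 = 1 :> R.
Proof. by rewrite /root_r powR1. Qed.

Lemma strength_ratio_gt0 r x1 x2 : 0 < x1 -> 0 < x2 ->
  0 < strength_ratio r x1 x2.
Proof. by move=> h1 h2; rewrite powR_gt0 // divr_gt0. Qed.

(** Taking r-th roots trades the scale of one player for that of the other. *)
Lemma root_r_rescale r x1 x2 s : 0 < r -> 0 < x1 -> 0 < x2 -> 0 <= s ->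
  x2 * root_r r (strength_ratio r x1 x2 * s) = x1 * root_r r s.
Proof.
move=> r0 h1 h2 s0.
rewrite /root_r powRM ?powR_ge0 // -/(root_r r (strength_ratio _ _ _)).
rewrite /root_r /strength_ratio -powRrM divff ?gt_eqF // powRr1 ?divr_ge0 ?ltW //.
by rewrite mulrA mulrCA mulfV ?gt_eqF // mulr1.
Qed.

Lemma fail_prob_root r xmax s : 0 < r -> 0 < xmax -> 0 <= s ->
  fail_prob r xmax (xmax * root_r r s) = Num.min s 1.
Proof.
move=> r0 h s0; rewrite /fail_prob.
rewrite -{2}[xmax]mulr1 ltr_pM2l // -{1}(root_r1 r) root_r_lt //.
case: ltP => // _.
by rewrite mulrAC mulfV ?gt_eqF // mul1r root_r_powR.
Qed.

Lemma leader_utility_gain W1 W2 c1 c2 x1 x2 r s :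
  W2 < W1 -> 0 <= c1 -> 0 < x1 -> 0 < x2 -> 0 < r -> 0 <= s ->
  leader_utility W1 W2 c1 c2 x1 x2 r (x1 * root_r r s) =
  W2 + (W1 - W2) * leader_gain (strength_ratio r x1 x2)
         (1 / (1 + norm_cost W1 W2 c1)) (norm_cost W1 W2 c2) s.
Proof.
move=> hW hc1 h1 h2 r0 s0.
have D0 : 0 < W1 - W2 by rewrite subr_gt0.
have a0 : 0 <= norm_cost W1 W2 c1 by rewrite divr_ge0 // ltW.
have c2E : c2 = norm_cost W1 W2 c2 * (W1 - W2).
  by rewrite /norm_cost mulfVK // gt_eqF.
have al0 := strength_ratio_gt0 r _ _ h1 h2.
rewrite /leader_utility /x_threshold ltr_pM2l //.
rewrite root_r_lt // ?divr_ge0 ?addr_ge0 //.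
rewrite fail_prob_root // -(root_r_rescale r x1 x2) //.
rewrite fail_prob_root //; last by rewrite mulr_ge0 // ltW.
rewrite /leader_gain; move: c2E.
set b := norm_cost W1 W2 c2; set f2 := Num.min (_ * s) 1 => ->.
case: ltP => [se|_]; last by ring.
have s1 : s < 1.
  by apply: lt_le_trans se _; rewrite div1r invf_le1 ?lerDl ?ltr_wpDr.
by rewrite (min_idPl (ltW s1)); ring.
Qed.

(** Every effort has the form x1max * root_r r s with s >= 0, so maximizing over
    efforts is maximizing over s. *)
Lemma optimal_effort_gain W1 W2 c1 c2 x1 x2 r s :
  W2 < W1 -> 0 <= c1 -> 0 < x1 -> 0 < x2 -> 0 < r -> 0 <= s ->
  (forall t, 0 <= t ->
     leader_gain (strength_ratio r x1 x2)
       (1 / (1 + norm_cost W1 W2 c1)) (norm_cost W1 W2 c2) t <=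
     leader_gain (strength_ratio r x1 x2)
       (1 / (1 + norm_cost W1 W2 c1)) (norm_cost W1 W2 c2) s) ->
  optimal_effort (leader_utility W1 W2 c1 c2 x1 x2 r) (x1 * root_r r s).
Proof.
move=> hW hc1 h1 h2 r0 s0 best; split.
  by rewrite mulr_ge0 ?root_r_ge0 // ltW.
move=> y y0.
have -> : y = x1 * root_r r ((y / x1) `^ r).
  rewrite /root_r -powRrM divff ?gt_eqF // powRr1 ?divr_ge0 // ?ltW //.
  by rewrite mulrCA mulfV ?gt_eqF // mulr1.
rewrite !leader_utility_gain ?powR_ge0 // lerD2l ler_pM2l ?subr_gt0 //.
exact/best/powR_ge0.
Qed.

End Reduction.

(** * Comparing the three candidate efforts *)

Section Comparison.
Context {R : realType}.
Implicit Types (al e b s M : R).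

(** An upper bound for the gain has to be checked on the matching branch where
    the leader may succeed, and on the folding branch only at its left end,
    as 1 - (1 + b) f2 decreases in f2.  That last value is at least the gain - b
    of a leader who fails for sure, which covers the rest. *)
Lemma leader_gain_le al e b M :
  0 < al -> 0 <= b ->
  (forall s, 0 <= s -> s < e -> s * (1 - al * s) - b * (al * s) <= M) ->
  1 - (1 + b) * Num.min (al * e) 1 <= M ->
  forall s, 0 <= s -> leader_gain al e b s <= M.
Proof.
move=> al0 b0 matchM foldM s s0; rewrite /leader_gain.
have failM : - b <= M.
  apply: le_trans foldM.
  have f21 : Num.min (al * e) 1 <= 1 by rewrite ge_min lexx orbT.
  have : 0 <= (1 + b) * (1 - Num.min (al * e) 1).
    by rewrite mulr_ge0 ?subr_ge0 // addr_ge0.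
  lra.
case: ltP => se; last first.
  apply: le_trans foldM; rewrite lerD2l lerN2 ler_wpM2l ?addr_ge0 //.
  by rewrite le_min !ge_min ler_pM2l // se lexx orbT.
case: (leP (al * s) 1) => _; first exact: matchM.
lra.
Qed.

Lemma leader_gain_fold al e b :
  leader_gain al e b e = 1 - (1 + b) * Num.min (al * e) 1.
Proof. by rewrite /leader_gain ltxx. Qed.

Lemma leader_gain0 al e b :
  0 < e -> leader_gain al e b 0 = 0.
Proof.
by move=> e0; rewrite /leader_gain e0 mulr0 (min_idPl ler01) mul0r mulr0 subr0.
Qed.

(** The parabola has slope 1 - b al at 0, and 1 - (1 + b) al e is the gain when
    the follower folds at e. *)
Lemma zero_effort_best al e b :
  0 < al -> 0 < e -> 0 <= b ->
  1 <= b * al -> 1 <= (1 + b) * (al * e) ->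
  forall s, 0 <= s -> leader_gain al e b s <= leader_gain al e b 0.
Proof.
move=> al0 e0 b0 slope fold; rewrite leader_gain0 //; apply: leader_gain_le => //.
  move=> s s0 _.
  have : 0 <= s * (b * al - 1) by rewrite mulr_ge0 // subr_ge0.
  have : 0 <= al * s ^+ 2 by rewrite mulr_ge0 ?sqr_ge0 // ltW.
  lra.
by case: (leP (al * e) 1) => _; lra.
Qed.

(** As long as the peak of the parabola is not interior to the matching region,
    the parabola is at most its value e (1 - al e) - b al e at e, which is below
    the folding gain since e <= 1. *)
Lemma fold_best_before_entry al e b :
  0 < al -> 0 < e -> e <= 1 -> 0 <= b ->
  al * (b + 2 * e) <= 1 ->
  forall s, 0 <= s -> leader_gain al e b s <= leader_gain al e b e.
Proof.
move=> al0 e0 e1 b0 entry; rewrite leader_gain_fold.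
have ale1 : al * e <= 1 by nra.
rewrite (min_idPl ale1); apply: leader_gain_le => //; last by rewrite (min_idPl ale1).
move=> s s0 se.
have incr : 0 <= (e - s) * (1 - b * al - al * (s + e)).
  by apply: mulr_ge0; nra.
nra.
Qed.

Lemma matching_gain_le_peak al b s :
  0 < al ->
  s * (1 - al * s) - b * (al * s) <= (1 - b * al) ^+ 2 / (4 * al).
Proof.
move=> al0.
rewrite ler_pdivlMr ?mulr_gt0 //.
have := sqr_ge0 (2 * al * s - (1 - b * al)).
nra.
Qed.

(** The hypothesis says that the folding gain at e is at least the height of the
    peak; in particular it is nonnegative, so that al e <= 1. *)
Lemma fold_best_over_peak al e b :
  0 < al -> 0 < e -> 0 <= b ->
  (1 - b * al) ^+ 2 <= 4 * al * (1 - (1 + b) * e * al) ->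
  forall s, 0 <= s -> leader_gain al e b s <= leader_gain al e b e.
Proof.
move=> al0 e0 b0 q; rewrite leader_gain_fold.
have fold0 : 0 <= 1 - (1 + b) * e * al.
  have h4 : 0 < 4 * al by rewrite mulr_gt0.
  by rewrite -(pmulr_rge0 _ h4); apply: le_trans q; exact: sqr_ge0.
have ale1 : al * e <= 1.
  have : 0 <= b * (al * e) by rewrite !mulr_ge0 // ltW.
  nra.
rewrite (min_idPl ale1); apply: leader_gain_le => //; last by rewrite (min_idPl ale1).
move=> s _ _; apply: le_trans (matching_gain_le_peak al b s al0) _.
rewrite ler_pdivrMr ?mulr_gt0 //; nra.
Qed.

(** The excess of the folding gain at e over the parabola is affine in al.  It
    interpolates between 1 - s at al = 0 and al s (b (1 - e) - (e - s)) at the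
    value of al for which folding at e gives gain 0. *)
Lemma fold_best_high_costs al e b :
  0 < al -> 0 < e -> e <= 1 -> 0 <= b ->
  e <= b * (1 - e) -> (1 + b) * (al * e) <= 1 ->
  forall s, 0 <= s -> leader_gain al e b s <= leader_gain al e b e.
Proof.
move=> al0 e0 e1 b0 costs fold0; rewrite leader_gain_fold.
have ale1 : al * e <= 1.
  have : 0 <= b * (al * e) by rewrite !mulr_ge0 // ltW.
  nra.
rewrite (min_idPl ale1); apply: leader_gain_le => //; last by rewrite (min_idPl ale1).
move=> s s0 se.
have h1 : 0 <= (1 - (1 + b) * (al * e)) * (1 - s) by apply: mulr_ge0; lra.
have h2 : 0 <= al * s * (b * (1 - e) - e + s).
  by apply: mulr_ge0; [rewrite mulr_ge0 // ltW | lra].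
nra.
Qed.

(** The peak lies in the matching region or, in a boundary case, at e itself; at
    e folding only increases the gain.  So the height of the parabola bounds
    the gain there from below in both cases. *)
Lemma peak_best al e b :
  0 < al -> 0 < e -> e <= 1 -> 0 <= b ->
  b * al <= 1 -> 1 <= al * (b + 2 * e) ->
  4 * al * (1 - (1 + b) * e * al) <= (1 - b * al) ^+ 2 ->
  forall s, 0 <= s ->
  leader_gain al e b s <= leader_gain al e b ((1 - b * al) / (2 * al)).
Proof.
move=> al0 e0 e1 b0 slope entry q s s0.
set p := (1 - b * al) / (2 * al).
have pE : 2 * al * p = 1 - b * al.
  by rewrite /p mulrCA mulfV ?mulr1 // gt_eqF // mulr_gt0.
have p0 : 0 <= p by rewrite divr_ge0 ?subr_ge0 // mulr_ge0 // ltW.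
have pe : p <= e by rewrite -(ler_pM2l al0); nra.
have alp1 : al * p <= 1 by have : 0 <= b * al by [rewrite mulr_ge0 // ltW]; lra.
have peakE : (1 - b * al) ^+ 2 / (4 * al) = p * (1 - al * p) - b * (al * p).
  apply: (mulIf (x := 4 * al)); first by rewrite gt_eqF // mulr_gt0.
  rewrite mulfVK; last by rewrite gt_eqF // mulr_gt0.
  rewrite -pE; have -> : b * (al * p) = (1 - 2 * al * p) * p by rewrite pE; ring.
  by ring.
have peak0 : 0 <= (1 - b * al) ^+ 2 / (4 * al).
  by rewrite divr_ge0 ?sqr_ge0 // mulr_ge0 // ltW.
apply: (@le_trans _ _ ((1 - b * al) ^+ 2 / (4 * al))); last first.
  rewrite peakE /leader_gain (min_idPl alp1); case: ltP => // _.
  have : 0 <= (1 - p) * (1 - al * p) by apply: mulr_ge0; lra.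
  nra.
move: s s0; apply: leader_gain_le => // [s _ _|]; first exact: matching_gain_le_peak.
case: (leP (al * e) 1) => _; last by lra.
rewrite ler_pdivlMr ?mulr_gt0 //; nra.
Qed.

End Comparison.

(** * The critical strength ratio *)

Section AlphaStar.
Context {R : realType} {a b : R}.
Hypotheses (a0 : 0 <= a) (b0 : 0 <= b).
Let e : R := 1 / (1 + a).
Let P : R := 4 * ((1 + b) * e) + b ^+ 2.
Let S : R := Num.sqrt (a * (1 + b) / (1 + a)).

Lemma fold_prob_bounds : [/\ 0 < e, e <= 1 & e * (1 + a) = 1].
Proof.
have a1 : 0 < 1 + a by rewrite ltr_wpDr.
split; first by rewrite divr_gt0.
  by rewrite /e div1r invf_le1 // lerDl.
by rewrite /e div1r mulVf // gt_eqF.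
Qed.

Let P0 : 0 < P.
Proof.
have [e0 _ _] := fold_prob_bounds.
by rewrite ltr_wpDr ?sqr_ge0 // mulr_gt0 // mulr_gt0 // ltr_wpDr.
Qed.

Let S0 : 0 <= S. Proof. exact: sqrtr_ge0. Qed.

Let S2 : S ^+ 2 = (1 - e) * (1 + b).
Proof.
have [e0 e1 ea] := fold_prob_bounds.
rewrite sqr_sqrtr; last by rewrite divr_ge0 ?mulr_ge0 ?addr_ge0.
have -> : a * (1 + b) / (1 + a) = (1 + b) * (a * e) by rewrite /e; ring.
by have -> : a * e = 1 - e by [lra]; rewrite mulrC.
Qed.

Let alpha_starE : P * alpha_star a b = 2 + b + 2 * S.
Proof.
have PE : P = 4 * ((1 + b) / (1 + a)) + b ^+ 2 by rewrite /P /e; ring.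
by rewrite /alpha_star -PE mulrC mulfVK // gt_eqF.
Qed.

(** P is the leading coefficient of q, and the discriminant of q is 16 S^2: this
    is P q with its square completed. *)
Let quadratic_square al :
  P * ((1 - b * al) ^+ 2 - 4 * al * (1 - (1 + b) * e * al)) =
  (P * al - (2 + b)) ^+ 2 - 4 * S ^+ 2.
Proof. by rewrite S2 /P; ring. Qed.

Lemma alpha_star_ge_entry al : alpha_star a b <= al -> 1 <= al * (b + 2 * e).
Proof.
have [e0 e1 _] := fold_prob_bounds.
have [b_ge0 S_ge0] := (b0, S0).
rewrite -(ler_pM2l P0 _ al) alpha_starE => le_al.
rewrite -(ler_pM2l P0) mulr1 mulrA.
have h : (2 + b) * (b + 2 * e) <= P * al * (b + 2 * e).
  by rewrite ler_wpM2r; lra.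
apply: le_trans h.
have : 0 <= b * (1 - e) by rewrite mulr_ge0 // subr_ge0.
rewrite /P; lra.
Qed.

Lemma alpha_ge_star al : alpha_star a b <= al ->
  4 * al * (1 - (1 + b) * e * al) <= (1 - b * al) ^+ 2.
Proof.
have S_ge0 := S0.
rewrite -(ler_pM2l P0 _ al) alpha_starE => le_al.
rewrite -subr_ge0 -(pmulr_rge0 _ P0) quadratic_square.
nra.
Qed.

(** Once the peak has entered the matching region, al is larger than the smaller
    root of q: at the entry, P al - (2 + b) >= - 2 S amounts to
    b (1 - e) <= S (b + 2 e), whose square follows from S^2 = (1 - e) (1 + b). *)
Lemma alpha_lt_star al : al < alpha_star a b -> 1 < al * (b + 2 * e) ->
  (1 - b * al) ^+ 2 <= 4 * al * (1 - (1 + b) * e * al).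
Proof.
have [e0 e1 _] := fold_prob_bounds.
have [b_ge0 S_ge0] := (b0, S0).
rewrite -(ltr_pM2l P0 al) alpha_starE => lt_al entry.
have be0 : 0 < b + 2 * e by lra.
have key : b * (1 - e) <= S * (b + 2 * e).
  rewrite -(@ler_pXn2r _ 2) ?nnegrE //; last first.
  - by rewrite mulr_ge0 // ltW.
  - by rewrite mulr_ge0 // subr_ge0.
  rewrite !exprMn S2 -subr_ge0.
  have -> : (1 - e) * (1 + b) * (b + 2 * e) ^+ 2 - b ^+ 2 * (1 - e) ^+ 2 =
    (1 - e) * (b ^+ 3 + 4 * (1 + b) * (b + e) * e + b ^+ 2 * e) by ring.
  apply: mulr_ge0; first lra.
  have b3 : 0 <= b ^+ 3 by exact: exprn_ge0.
  have be : 0 <= (1 + b) * (b + e) * e by apply: mulr_ge0; [apply: mulr_ge0|]; lra.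
  have b2e : 0 <= b ^+ 2 * e by rewrite mulr_ge0 ?sqr_ge0 // ltW.
  lra.
have above : - (2 * S) <= P * al - (2 + b).
  rewrite -(ler_pM2r be0).
  have : (2 + b) * (b + 2 * e) - 2 * (b * (1 - e)) <= P * al * (b + 2 * e).
    have <- : P = (2 + b) * (b + 2 * e) - 2 * (b * (1 - e)) by rewrite /P; ring.
    by rewrite -mulrA ler_peMr // ltW.
  lra.
rewrite -subr_le0 -(pmulr_rle0 _ P0) quadratic_square.
have : 0 <= (2 * S - (P * al - (2 + b))) * (2 * S + (P * al - (2 + b))).
  by apply: mulr_ge0; lra.
lra.
Qed.

End AlphaStar.

(** * The optimal effort *)

Theorem theorem2 (R : realType) (W1 W2 c1 c2 x1max x2max r : R)
    (hW2 : 0 <= W2) (hW : W2 < W1) (hc1 : 0 <= c1) (hc2 : 0 <= c2)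
    (hx1 : 0 < x1max) (hx2 : 0 < x2max) (hr : 1 <= r) :
  let cb1 := norm_cost W1 W2 c1 in
  let cb2 := norm_cost W1 W2 c2 in
  let alpha := strength_ratio r x1max x2max in
  let optimal := optimal_effort (leader_utility W1 W2 c1 c2 x1max x2max r) in
  (1 <= cb1 * cb2 ->
     (0 <= alpha < (1 + cb1) / (1 + cb2) ->
        optimal (x1max * root_r r (1 / (1 + cb1)))) /\
     ((1 + cb1) / (1 + cb2) <= alpha ->
        optimal 0)) /\
  (cb1 * cb2 < 1 ->
     (0 <= alpha < alpha_star cb1 cb2 ->
        optimal (x1max * root_r r (1 / (1 + cb1)))) /\
     (alpha_star cb1 cb2 <= alpha -> (alpha%:E < inv_cost cb2)%E ->
        optimal (x2max * root_r r (1 / 2 * (1 - cb2 * alpha)))) /\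
     ((inv_cost cb2 <= alpha%:E)%E ->
        optimal 0)).
Proof.
move=> cb1 cb2 alpha optimal.
have r0 : 0 < r by exact: lt_le_trans hr.
have D0 : 0 < W1 - W2 by rewrite subr_gt0.
have a0 : 0 <= cb1 by rewrite divr_ge0 // ltW.
have b0 : 0 <= cb2 by rewrite divr_ge0 // ltW.
have al0 : 0 < alpha by exact: strength_ratio_gt0.
have [e0 e1 ea] := fold_prob_bounds a0.
set e := 1 / (1 + cb1) in e0 e1 ea *.
have reduce s : 0 <= s ->
    (forall t, 0 <= t -> leader_gain alpha e cb2 t <= leader_gain alpha e cb2 s) ->
    optimal (x1max * root_r r s).
  exact: optimal_effort_gain.
have reduce0 : 1 <= cb2 * alpha -> 1 <= (1 + cb2) * (alpha * e) -> optimal 0.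
  move=> slope fold; rewrite -(mulr0 x1max) -(root_r0 _ r0).
  by apply: reduce => //; exact: zero_effort_best.
have b1 : 0 < 1 + cb2 by rewrite ltr_wpDr.
have eab : e * (cb1 * cb2) = (1 - e) * cb2.
  by rewrite mulrA; have -> : e * cb1 = 1 - e by lra.
split=> costs; [split | split; [|split]].
- case/andP=> _; rewrite ltr_pdivlMr // => lt_al; apply: reduce; first exact: ltW.
  apply: fold_best_high_costs => //.
    by move: costs; rewrite -(ler_pM2l e0 1) eab; lra.
  by move: (ltW lt_al); rewrite -(ler_pM2l e0 _ (1 + cb1)) ea; lra.
- rewrite ler_pdivrMr // => ge_al.
  have fold : 1 <= (1 + cb2) * (alpha * e).
    by move: ge_al; rewrite -(ler_pM2l e0 (1 + cb1)) ea; lra.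
  apply: reduce0 => //.
  (* (1 + cb1) cb2 >= 1 + cb2 turns the folding bound into the slope bound. *)
  have : 1 + cb2 <= (1 + cb1) * cb2 by lra.
  have : (1 + cb1) * cb2 <= alpha * (1 + cb2) * cb2 by rewrite ler_wpM2r.
  move=> h1 h2; rewrite -(ler_pM2l b1); lra.
- case/andP=> _ lt_al; apply: reduce; first exact: ltW.
  case: (leP (alpha * (cb2 + 2 * e)) 1) => entry.
    exact: fold_best_before_entry.
  by apply: fold_best_over_peak => //; exact: alpha_lt_star.
- move=> ge_al lt_inv.
  have slope : cb2 * alpha <= 1.
    move: lt_inv; have [->|cb2N0] := eqVneq cb2 0; first by rewrite mul0r ler01.
    have cb2P : 0 < cb2 by rewrite lt_def cb2N0.
    by rewrite inv_cost_neq0 // lte_fin ltr_pdivlMr // mulrC => /ltW.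
  have -> : 1 / 2 * (1 - cb2 * alpha) = alpha * ((1 - cb2 * alpha) / (2 * alpha)).
    by field; rewrite gt_eqF.
  have p0 : 0 <= (1 - cb2 * alpha) / (2 * alpha).
    by rewrite divr_ge0 ?subr_ge0 // mulr_ge0 // ltW.
  rewrite root_r_rescale //; apply: reduce => //.
  apply: peak_best => //; first exact: alpha_star_ge_entry.
  exact: alpha_ge_star.
- have [->|cb2N0] := eqVneq cb2 0; first by rewrite inv_cost0 leNgt ltry.
  have cb2P : 0 < cb2 by rewrite lt_def cb2N0.
  rewrite inv_cost_neq0 // lee_fin ler_pdivrMr // => slope.
  apply: reduce0; first by rewrite mulrC.
  (* e (1 + cb2) > cb2 because cb1 cb2 < 1, and cb2 alpha >= 1. *)
  have lt_e : cb2 < e * (1 + cb2).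
    by move: costs; rewrite -(ltr_pM2l e0 _ 1) eab; lra.
  have : cb2 * alpha < e * (1 + cb2) * alpha by rewrite ltr_pM2r.
  lra.
Qed.
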